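(* Let $E$ be a finite set and $\mathcal{L}$ a set of subsets of $E$ with $|\mathcal{L}|=n$, and suppose the toggle group $T(\mathcal{L})$ acts transitively on $\mathcal{L}$. If $T(\mathcal{L})$ contains a transposition, then $T(\mathcal{L})$ is the full symmetric group on $\mathcal{L}$ (so $T(\mathcal{L})\cong S_n$).
   Context: For $e\in E$, the toggle $\tau_e:\mathcal{L}\to\mathcal{L}$ is defined by $\tau_e(X)=X\triangle\{e\}$ if $X\triangle\{e\}\in\mathcal{L}$, and $\tau_e(X)=X$ otherwise. The toggle group $T(\mathcal{L})$ is the subgroup of the symmetric group on $\mathcal{L}$ generated by $\{\tau_e: e\in E\}$; its degree is $|\mathcal{L}|$. *)

(* Defs.v *)
From mathcomp Require Import all_boot all_fingroup.

Set Implicit Arguments.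
Unset Strict Implicit.
Unset Printing Implicit Defensive.

Section Toggle.

Variables (E : finType) (L : {set {set E}}).

Definition symdiff (A B : {set E}) : {set E} := (A :\: B) :|: (B :\: A).

Local Notation member := {X : {set E} | X \in L}.

(* [insubd X Y] is Y viewed in L when Y \in L, and X otherwise. *)
Definition toggle (e : E) (X : member) : member :=
  insubd X (symdiff (val X) [set e]).

Lemma symdiffK (e : E) (A : {set E}) :
  symdiff (symdiff A [set e]) [set e] = A.
Proof.
by apply/setP=> x; rewrite !inE; case: (x == e); case: (x \in A).
Qed.

Lemma toggleK (e : E) : involutive (toggle e).
Proof.
move=> X; apply: val_inj; rewrite /toggle.
have [sL | sNL] := boolP (symdiff (val X) [set e] \in L).
  have vE : val (insubd X (symdiff (val X) [set e])) = symdiff (val X) [set e].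
    by rewrite val_insubd sL.
  by rewrite val_insubd vE symdiffK (valP X).
have -> : insubd X (symdiff (val X) [set e]) = X.
  by apply: val_inj; rewrite val_insubd (negbTE sNL).
by rewrite val_insubd (negbTE sNL).
Qed.

Definition toggle_perm (e : E) : {perm member} := perm (can_inj (toggleK e)).

Definition toggle_group : {group {perm member}} :=
  <<[set toggle_perm e | e : E]>>%G.

End Toggle.

Notation member L := {X : {set _} | X \in L}.

(* Main.v *)
(* Call X and Y linked when the transposition (X Y) lies in the toggle group G;
   the classes of this equivalence are blocks of G, and G is the full symmetric
   group as soon as there is only one class. Suppose there are several. Call a
   toggle outer if it sends some set to another class, and inner otherwise. An
   outer toggle only moves sets from one class to another, so it translates
   each class that it does not fix pointwise; hence outer toggles commute with
   inner ones and generate a normal subgroup H of G. If (X Y) is in G and the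
   toggle t sends X to another class, then (X Y) fixes t(X), so the product of
   t and its conjugate by (X Y), which lies in H, maps Y to X. If Y were the
   image of X under an inner toggle at e, this would be absurd, as outer toggles
   do not affect membership of e: no toggle moves a set within its class. Each
   toggle thus translates each class or fixes it pointwise, and translation by
   the symmetric difference U of X and Y is a permutation s that commutes with
   all toggles. Given e, pick u in U distinct from e: s swaps the sets that
   contain u with those that do not, while the toggle at e preserves both
   families, so this toggle is even. But (X Y) is odd. *)

Require Import Defs.
From mathcomp Require Import all_boot all_fingroup.
From mathcomp Require Import alt.

Set Implicit Arguments.
Unset Strict Implicit.
Unset Printing Implicit Defensive.

Local Open Scope group_scope.

Lemma isog_perm (T U : finType) :
  #|T| = #|U| -> [set: {perm T}] \isog [set: {perm U}].
Proof.
move=> eqTU.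
pose f x := enum_val (cast_ord eqTU (enum_rank x)) : U.
pose f' y := enum_val (cast_ord (esym eqTU) (enum_rank y)) : T.
have fK : cancel f f' by move=> x; rewrite /f' enum_valK cast_ordK enum_rankK.
have f'K : cancel f' f by move=> y; rewrite /f enum_valK cast_ordKV enum_rankK.
have inj (s : {perm T}) : injective (f \o s \o f').
  exact: inj_comp (inj_comp (can_inj fK) perm_inj) (can_inj f'K).
pose phi s := perm (inj s).
have phiM : {in setT &, {morph phi : s t / s * t}}.
  by move=> s t _ _; apply/permP=> y; rewrite permM 3!permE /= fK permM.
apply/isogP; exists (Morphism phiM).
  apply/injmP=> s t _ _ /permP eq_phi; apply/permP=> x.
  by have:= eq_phi (f x); rewrite !permE /= fK => /(can_inj fK).
apply/eqP; rewrite morphimEdom -subTset; apply/subsetP=> s _.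
have inj' : injective (f' \o s \o f).
  exact: inj_comp (inj_comp (can_inj f'K) perm_inj) (can_inj fK).
apply/imsetP; exists (perm inj'); first by rewrite inE.
by apply/permP=> y; rewrite !permE /= permE /= !f'K.
Qed.

(* The restrictions of [t] to [H] and to its complement are conjugate under
   [s]. *)
Lemma even_perm_swapped_halves (T : finType) (H : {set T}) (s t : {perm T}) :
    (forall x, (s x \in H) = (x \notin H)) -> t \in 'N(H | 'P) ->
    commute s t ->
  ~~ odd_perm t.
Proof.
move=> sH nHt st; set u := restr_perm H t.
have uH x : x \in H -> u x = t x by exact: restr_permE.
have uNH x : x \notin H -> u x = x by apply: (out_perm (restr_perm_on H t)).
have tH x : (t x \in H) = (x \in H) by exact: (astabsP nHt).
suff ->: t = u * u ^ s by rewrite odd_permM odd_permJ addbb.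
apply/permP=> x; rewrite permM; have [xH | xNH] := boolP (x \in H).
  rewrite uH // -[t x](permKV s) permJ [u _]uNH //.
  by rewrite -sH permKV tH.
rewrite uNH // -[x](permKV s) permJ uH; first by rewrite -!permM st.
by rewrite -[_ \in H]negbK -sH permKV.
Qed.

Lemma atrans_gen_ind (T : finType) (A : {set {perm T}}) (P : pred T) (x : T) :
    [transitive <<A>>, on [set: T] | 'P] ->
    P x -> (forall a y, a \in A -> P y -> P (a y)) ->
  forall y, P y.
Proof.
move=> trA Px PA y; pose S := [set z | P z].
have nSA : <<A>> \subset 'N(S | 'P).
  rewrite gen_subG; apply/subsetP=> a aA; rewrite !inE /=.
  by apply/subsetP=> z; rewrite !inE; apply: PA.
have [g gA ->] := atransP2 trA (in_setT x) (in_setT y).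
by have:= astabsP (subsetP nSA g gA) x; rewrite !inE Px.
Qed.

Section TpermLinked.

Variables (T : finType) (G : {group {perm T}}).
Implicit Types (x y z : T) (g : {perm T}).

Definition tperm_linked : rel T := fun x y => tperm x y \in G.

Lemma tperm_linked_refl x : tperm_linked x x.
Proof. by rewrite /tperm_linked tperm1 group1. Qed.

Lemma tperm_linked_sym : symmetric tperm_linked.
Proof. by move=> x y; rewrite /tperm_linked tpermC. Qed.

Lemma tperm_linked_act g x y :
  g \in G -> tperm_linked (g x) (g y) = tperm_linked x y.
Proof. by move=> gG; rewrite /tperm_linked -tpermJ groupJr. Qed.

Lemma tperm_linked_trans : transitive tperm_linked.
Proof.
move=> y x z xy yz; have [<- | nxz] := eqVneq x z.
  exact: tperm_linked_refl.
have [<- // | nyx] := eqVneq y x.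
rewrite -[x](@tpermD _ y z) // 1?eq_sym //.
by rewrite -{2}(tpermL y z) tperm_linked_act.
Qed.

Lemma tperm_linked_ltrans : left_transitive tperm_linked.
Proof. exact: sym_left_transitive tperm_linked_sym tperm_linked_trans. Qed.

Lemma tperm_linked_rtrans : right_transitive tperm_linked.
Proof. exact: sym_right_transitive tperm_linked_sym tperm_linked_trans. Qed.

Lemma tperm_linked_setT :
  (forall x y, tperm_linked x y) -> G = [set: {perm T}] :> {set {perm T}}.
Proof.
move=> tG; apply/setP=> s; rewrite inE.
by have [ts -> _] := prod_tpermP s; apply: group_prod => i _; apply: tG.
Qed.

End TpermLinked.

Section SymDiff.

Variable E : finType.
Implicit Types (A B C : {set E}) (e : E).

Lemma in_symdiff A B e : (e \in symdiff A B) = (e \in A) (+) (e \in B).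
Proof. by rewrite !inE; case: (e \in A); case: (e \in B). Qed.

Lemma symdiff_eq0 A B : (symdiff A B == set0) = (A == B).
Proof. by rewrite setU_eq0 !setD_eq0 eqEsubset. Qed.

Lemma symdiffKl A B : symdiff A (symdiff A B) = B.
Proof. by apply/setP=> e; rewrite !in_symdiff addKb. Qed.

Lemma symdiffKr A B : symdiff (symdiff A B) B = A.
Proof. by apply/setP=> e; rewrite !in_symdiff addbK. Qed.

Lemma symdiffAC A B C : symdiff (symdiff A B) C = symdiff (symdiff A C) B.
Proof. by apply/setP=> e; rewrite !in_symdiff addbAC. Qed.

End SymDiff.

Section TogglePerm.

Variables (E : finType) (L : {set {set E}}).

Local Notation T := (member L).
Local Notation G := (toggle_group L).
Local Notation tau := (@toggle_perm E L).
Local Notation linked := (tperm_linked G).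

Implicit Types (e f u : E) (U : {set E}) (X Y Z V W : T).

Lemma toggle_permK e : involutive (tau e).
Proof. by move=> X; rewrite !permE toggleK. Qed.

Lemma val_toggle_perm e X :
  tau e X != X -> val (tau e X) = symdiff (val X) [set e].
Proof.
by rewrite -val_eqE permE /= val_insubd; case: ifP => // _; rewrite eqxx.
Qed.

Lemma toggle_perm_eq e X Y :
  val Y = symdiff (val X) [set e] -> tau e X = Y.
Proof.
by move=> YE; apply: val_inj; rewrite permE val_insubd -YE (valP Y).
Qed.

Lemma toggle_perm_astabs e f :
  f != e -> tau f \in 'N([set X : T | e \in val X] | 'P).
Proof.
move=> nfe; apply/astabsP=> X; rewrite !inE /= apermE.
have [-> // | /val_toggle_perm ->] := eqVneq (tau f X) X.
by rewrite in_symdiff inE eq_sym (negbTE nfe) addbF.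
Qed.

Lemma mem_toggle_perm e : tau e \in G.
Proof. exact/mem_gen/imset_f. Qed.

Lemma toggle_group_sub (H : {group {perm T}}) :
  (forall e, tau e \in H) -> G \subset H.
Proof.
move=> tauH; rewrite gen_subG; apply/subsetP=> _ /imsetP[e _ ->].
exact: tauH.
Qed.

Lemma linked_toggle e X Y : linked (tau e X) (tau e Y) = linked X Y.
Proof. exact/tperm_linked_act/mem_toggle_perm. Qed.

Lemma linked_toggle_class e X Y :
  linked X Y -> linked Y (tau e Y) = linked X (tau e X).
Proof.
move=> XY; rewrite -(tperm_linked_ltrans XY); apply: esym.
by apply: tperm_linked_rtrans; rewrite linked_toggle.
Qed.

Lemma unlinked_toggle_neq e X : ~~ linked X (tau e X) -> tau e X != X.
Proof. by apply: contraNneq => ->; apply: tperm_linked_refl. Qed.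

Lemma linked_unlinked_toggle_comm e f X :
    linked X (tau e X) -> tau e X != X -> ~~ linked X (tau f X) ->
  tau e (tau f X) = tau f (tau e X).
Proof.
move=> XeX nX far; have far' : ~~ linked (tau e X) (tau f (tau e X)).
  by rewrite (linked_toggle_class f XeX).
apply: toggle_perm_eq; rewrite (val_toggle_perm (unlinked_toggle_neq far)).
rewrite (val_toggle_perm (unlinked_toggle_neq far')) (val_toggle_perm nX).
exact: symdiffAC.
Qed.

Definition outer e := [exists X, ~~ linked X (tau e X)].

Definition outer_toggle_group : {group {perm T}} :=
  <<[set tau e | e in outer]>>%G.

Lemma inner_linked e X : ~~ outer e -> linked X (tau e X).
Proof. by rewrite negb_exists => /forallP/(_ X); rewrite negbK. Qed.

Lemma outer_toggle_group_astabs e :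
  ~~ outer e -> outer_toggle_group \subset 'N([set X : T | e \in val X] | 'P).
Proof.
move=> inne; rewrite gen_subG; apply/subsetP=> _ /imsetP[f outf ->].
by apply/toggle_perm_astabs/(contraNneq _ inne) => <-.
Qed.

Hypothesis transG : [transitive G, on [set: T] | 'P].

Lemma toggle_ind (P : pred T) X :
  P X -> (forall e Y, P Y -> P (tau e Y)) -> forall Y, P Y.
Proof.
move=> PX Pt; apply: atrans_gen_ind transG PX _ => _ Y /imsetP[e _ ->].
exact: Pt.
Qed.

Lemma outer_linked_fix e X : outer e -> linked X (tau e X) -> tau e X = X.
Proof.
move=> oute XeX; apply/eqP; apply: contraTT oute => nX.
pose P Y := [exists Z, [&& linked Y Z, linked Z (tau e Z) & tau e Z != Z]].
suff PT Y : P Y.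
  rewrite negb_exists; apply/forallP=> Y; rewrite negbK.
  have /existsP[Z /and3P[YZ ZeZ _]] := PT Y.
  by rewrite -(linked_toggle_class e YZ).
apply: (@toggle_ind P X) => [|f W /existsP[Z /and3P[WZ ZeZ nZ]]].
  by apply/existsP; exists X; rewrite tperm_linked_refl XeX.
apply/existsP; have [ZfZ | far] := boolP (linked Z (tau f Z)).
  exists Z; rewrite ZeZ nZ !andbT.
  by rewrite (tperm_linked_rtrans ZfZ) linked_toggle.
exists (tau f Z); rewrite linked_unlinked_toggle_comm // !linked_toggle.
by rewrite WZ ZeZ (inj_eq perm_inj).
Qed.

Lemma inner_outer_commute e f :
  ~~ outer e -> outer f -> commute (tau e) (tau f).
Proof.
move=> inne outf; apply/permP=> X; rewrite !permM; apply: esym.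
have XeX := inner_linked X inne.
have [XfX | far] := boolP (linked X (tau f X)).
  rewrite (outer_linked_fix outf XfX); move: XfX.
  by rewrite -(linked_toggle_class f XeX) => /(outer_linked_fix outf)->.
have [eX | nX] := eqVneq (tau e X) X; last exact: linked_unlinked_toggle_comm.
set W := tau f X; have fW : tau f W = X by rewrite toggle_permK.
rewrite eX -/W; have [// | nW] := eqVneq (tau e W) W.
have farW : ~~ linked W (tau f W) by rewrite fW tperm_linked_sym.
have := linked_unlinked_toggle_comm (inner_linked W inne) nW farW.
by rewrite fW eX => XE; rewrite {2}/W XE toggle_permK.
Qed.

Lemma toggle_group_norm_outer : G \subset 'N(outer_toggle_group).
Proof.
apply: toggle_group_sub => e; have [oute | inne] := boolP (outer e).
  by apply: (subsetP (normG _)); apply/mem_gen/imset_f.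
apply: (subsetP (cent_sub _)); rewrite cent_gen.
by apply/centP=> _ /imsetP[f outf ->]; apply: inner_outer_commute.
Qed.

Section SeveralClasses.

Hypothesis unlinked_pair : exists X Y, ~~ linked X Y.

Lemma exists_unlinked_toggle X : exists e, ~~ linked X (tau e X).
Proof.
apply/existsP; apply: contraT => /existsPn near.
have linkedX : forall Y, linked X Y.
  apply: toggle_ind (tperm_linked_refl _ X) _ => e Y XY.
  by rewrite (tperm_linked_ltrans (negbNE (near e))) linked_toggle.
have [Y [Z]] := unlinked_pair.
by rewrite -(tperm_linked_ltrans (linkedX Y)) linkedX.
Qed.

Lemma linked_outer_orbit X Y :
  linked X Y -> X \in orbit 'P outer_toggle_group Y.
Proof.
move=> XY; have [e far] := exists_unlinked_toggle X.
have te : tau e \in outer_toggle_group.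
  by apply/mem_gen/imset_f/existsP; exists X.
have nHt := subsetP toggle_group_norm_outer _ XY.
apply/orbitP; exists (tau e ^ tperm X Y * tau e).
  by rewrite groupM // memJ_norm.
rewrite /= apermE permM -{2}(tpermL X Y) permJ tpermD ?toggle_permK //.
  by rewrite eq_sym unlinked_toggle_neq.
by apply: contraNneq far => <-.
Qed.

Lemma linked_toggle_fix e X : linked X (tau e X) -> tau e X = X.
Proof.
move=> XeX; have [oute | inne] := boolP (outer e).
  exact: outer_linked_fix.
have [h hH /(congr1 (fun Y => e \in val Y))] := orbitP (linked_outer_orbit XeX).
have := astabsP (subsetP (outer_toggle_group_astabs inne) h hH) (tau e X).
rewrite !inE => -> eE; apply/eqP; apply: contra_eqT eE => /val_toggle_perm->.
by rewrite in_symdiff inE eqxx; case: (e \in _).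
Qed.

Lemma linked_symdiff_toggle e X Y :
    linked X Y ->
  symdiff (val (tau e X)) (val (tau e Y)) = symdiff (val X) (val Y).
Proof.
move=> XY; have eXY := linked_toggle_class e XY.
have [XeX | farX] := boolP (linked X (tau e X)).
  have YeY : linked Y (tau e Y) by rewrite eXY.
  by rewrite (linked_toggle_fix XeX) (linked_toggle_fix YeY).
have farY : ~~ linked Y (tau e Y) by rewrite eXY.
rewrite (val_toggle_perm (unlinked_toggle_neq farX)).
rewrite (val_toggle_perm (unlinked_toggle_neq farY)).
apply/setP=> f; rewrite !in_symdiff.
by case: (f \in val X); case: (f \in val Y); case: (f \in [set e]).
Qed.

Definition linked_translation U (s : {perm T}) :=
  forall V, linked V (s V) /\ val (s V) = symdiff (val V) U.

Lemma linked_translation_exists X Y :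
  linked X Y -> exists s, linked_translation (symdiff (val X) (val Y)) s.
Proof.
move=> XY; set U := symdiff _ _.
pose P V := [exists W, linked V W && (symdiff (val V) (val W) == U)].
have PT : forall V, P V.
  apply: (@toggle_ind P X) => [|e V /existsP[W /andP[VW VWU]]].
    by apply/existsP; exists Y; rewrite XY eqxx.
  apply/existsP; exists (tau e W).
  by rewrite linked_toggle VW linked_symdiff_toggle.
have [|s sP] := @fin_all_exists T (fun=> T)
    (fun V W => linked V W /\ val W = symdiff (val V) U).
  move=> V; have /existsP[W /andP[VW /eqP VWU]] := PT V.
  by exists W; rewrite -VWU symdiffKl.
have s_inj : injective s.
  move=> V W sVW; apply: val_inj.
  have [[_ sV] [_ sW]] := (sP V, sP W).
  by rewrite -(symdiffKr (val V) U) -sV sVW sW symdiffKr.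
by exists (perm s_inj) => V; rewrite permE.
Qed.

Lemma linked_translation_commute U s e :
  linked_translation U s -> commute s (tau e).
Proof.
move=> sP; apply/permP=> V; rewrite !permM; apply: val_inj.
have [[VsV sV] [_ ->]] := (sP V, sP (tau e V)).
rewrite -[LHS](symdiffKl (val (tau e V))) (linked_symdiff_toggle e VsV).
by rewrite sV symdiffKl.
Qed.

Lemma linked_symdiff_neq1 e X Y :
  linked X Y -> X != Y -> exists2 u, u \in symdiff (val X) (val Y) & e != u.
Proof.
move=> XY nXY; apply/exists_inP; apply: contraT => /exists_inPn sub_e.
have : symdiff (val X) (val Y) \subset [set e].
  by apply/subsetP=> u /sub_e; rewrite negbK inE eq_sym.
rewrite subset1 symdiff_eq0 (inj_eq val_inj) (negbTE nXY) orbF => /eqP XYe.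
have eX : tau e X = Y by apply: toggle_perm_eq; rewrite -XYe symdiffKl.
by case/eqP: nXY; rewrite -eX linked_toggle_fix // eX.
Qed.

Lemma toggle_group_sub_Alt X Y : linked X Y -> X != Y -> G \subset 'Alt_T.
Proof.
move=> XY nXY; apply: toggle_group_sub => e; rewrite Alt_even.
have [s sP] := linked_translation_exists XY.
have [u Uu neu] := linked_symdiff_neq1 e XY nXY.
apply: (@even_perm_swapped_halves _ [set V : T | u \in val V] s).
- by move=> V; rewrite !inE; have [_ ->] := sP V; rewrite in_symdiff Uu addbT.
- exact: toggle_perm_astabs.
exact: linked_translation_commute sP.
Qed.

Lemma linked_eq X Y : linked X Y -> X = Y.
Proof.
move=> XY; apply/eqP; apply: contraT => nXY.
have := subsetP (toggle_group_sub_Alt XY nXY) _ XY.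
by rewrite Alt_even odd_tperm nXY.
Qed.

End SeveralClasses.

Lemma linked_total X Y : linked X Y -> X != Y -> forall Z W, linked Z W.
Proof.
move=> XY nXY Z W; apply: contraNT nXY => nZW; apply/eqP.
by apply: linked_eq XY; exists Z, W.
Qed.

End TogglePerm.

Theorem theorem3p1 (E : finType) (L : {set {set E}}) (n : nat)
    (cardL : #|L| = n)
    (transL : [transitive toggle_group L, on [set: member L] | 'P])
    (transp : exists X Y : member L,
       X <> Y /\ (tperm X Y \in toggle_group L)) :
  (toggle_group L = [set: {perm member L}] :> {set {perm member L}}) /\
  (toggle_group L \isog [set: 'S_n]).
Proof.
have [X [Y [/eqP nXY XY]]] := transp.
have GT : toggle_group L = [set: {perm member L}] :> {set {perm member L}}.
  exact/tperm_linked_setT/(linked_total transL XY nXY).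
split=> //; rewrite GT; apply: isog_perm.
by rewrite card_sig card_ord -cardL; apply: eq_card.
Qed.
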